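(* Let $X_n$ be the unitary Cayley graph of order $n$. Then the adjacency matrix of $L^3(X_n)=L(L(L(X_n)))$ has exactly four distinct eigenvalues if and only if $n=6$.
   Context: The unitary Cayley graph $X_n$ is the graph with vertex set $\mathbb{Z}_n=\{0,1,\ldots,n-1\}$ in which $i$ and $j$ are adjacent if and only if $\gcd(i-j,n)=1$. The line graph $L(G)$ of a graph $G$ has the edges of $G$ as vertices, two being adjacent if the corresponding edges share a vertex; $L^{k}(G)=L(L^{k-1}(G))$ with $L^0(G)=G$. *)

(* Defs.v *)
From HB Require Import structures.
From mathcomp Require Import all_boot all_order all_algebra.

Set Implicit Arguments.
Unset Strict Implicit.
Unset Printing Implicit Defensive.

Import Order.TTheory GRing.Theory Num.Theory.

Local Open Scope ring_scope.

Record sgraph := SGraph {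
  vertex : finType;
  adj : rel vertex;
  adj_sym : symmetric adj;
  adj_irrefl : irreflexive adj
}.

(* The conjunct [i != j] is implied by the gcd condition unless n = 1; it only
   excludes the loop that gcd(0, 1) = 1 would put on the single vertex of X_1. *)
Definition unitary_rel (n : nat) : rel 'I_n :=
  fun i j => (i != j) && (gcdz (i%:Z - j%:Z) n%:Z == 1).

Lemma unitary_rel_sym n : symmetric (@unitary_rel n).
Proof. by move=> i j; rewrite /unitary_rel eq_sym -opprB gcdNz. Qed.

Lemma unitary_rel_irrefl n : irreflexive (@unitary_rel n).
Proof. by move=> i; rewrite /unitary_rel eqxx. Qed.

Definition unitary_cayley (n : nat) : sgraph :=
  SGraph (@unitary_rel_sym n) (@unitary_rel_irrefl n).

Definition is_edge (G : sgraph) (e : {set vertex G}) : bool :=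
  [exists x, exists y, adj x y && (e == [set x; y])].

Definition edge (G : sgraph) : finType := {e : {set vertex G} | is_edge e}.

Definition line_rel (G : sgraph) : rel (edge G) :=
  fun e f => (e != f) && (val e :&: val f != set0).

Lemma line_rel_sym G : symmetric (@line_rel G).
Proof. by move=> e f; rewrite /line_rel eq_sym setIC. Qed.

Lemma line_rel_irrefl G : irreflexive (@line_rel G).
Proof. by move=> e; rewrite /line_rel eqxx. Qed.

Definition line_graph (G : sgraph) : sgraph :=
  SGraph (@line_rel_sym G) (@line_rel_irrefl G).

Definition iter_line_graph (k : nat) (G : sgraph) : sgraph :=
  iter k line_graph G.

Definition adjacency_mx (F : fieldType) (G : sgraph) : 'M[F]_#|vertex G| :=
  \matrix_(i, j) (adj (enum_val i) (enum_val j))%:R.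

Definition has_exactly_distinct_eigenvalues (F : fieldType) (m : nat)
    (A : 'M[F]_m) (k : nat) : Prop :=
  exists s : seq F,
    [/\ uniq s, size s = k & forall a : F, (a \in s) = eigenvalue A a].

(* Main.v *)
Require Import Defs.
From mathcomp Require Import all_boot all_order all_algebra.
From mathcomp Require Import ring zify.

Set Implicit Arguments.
Unset Strict Implicit.
Unset Printing Implicit Defensive.

Import Order.TTheory GRing.Theory Num.Theory.

Local Open Scope ring_scope.

(* For an r-regular graph G with incidence matrix B, the adjacency matrices satisfy
   B B^T = A(G) + r and B^T B = A(L(G)) + 2.  Hence an eigenvalue a <> -r of G gives
   the eigenvalue a + r - 2 of L(G), and -2 is an eigenvalue of L(G) as soon as
   r >= 3, since then there are more edges than vertices.  Three iterations give
   L^3(G) the five distinct eigenvalues -2, 4r - 10, 6r - 14, 8r - 14 and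
   a + 7r - 14, where a is an eigenvalue of G other than r and -r.

   X_n is regular, of degree at least 3 unless n is 1, 2, 3, 4 or 6.  For n <= 2 the
   graph L^3(X_n) is empty, and for n = 3, 4, 6 it is the cycle C_n, which has 2, 3
   and 4 distinct eigenvalues respectively. *)

(** * Eigenvalues through functions on the vertices *)

Section Eigenfunctions.

Variables (F : fieldType) (G : sgraph).
Implicit Types (a : F) (f : vertex G -> F).

Definition eigenfunction a f :=
  forall x, \sum_(y | adj x y) f y = a * f x.

(** [eigenvalue] concerns row vectors multiplied on the left of the matrix; symmetry of [adj] turns
    the column sums into sums over neighbours. Later arguments thus avoid the enumeration of
    vertices. *)
Lemma eigenvalue_adjacencyP a :
  reflect (exists2 f, eigenfunction a f & exists x, f x != 0)
          (eigenvalue (adjacency_mx F G) a).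
Proof.
apply: (iffP (eigenvalueP (g := adjacency_mx F G))).
  case=> v Av v0; exists (fun x => v ord0 (enum_rank x)); last first.
    by case/rV0Pn: v0 => i vi; exists (enum_val i); rewrite enum_valK.
  move=> x; move/matrixP/(_ ord0 (enum_rank x)): Av; rewrite !mxE => <-.
  rewrite big_mkcond (reindex (@enum_val _ (mem (vertex G)))) /=; last first.
    by apply: onW_bij; apply: enum_val_bij.
  apply: eq_bigr => i _; rewrite mxE enum_rankK enum_valK adj_sym.
  by case: adj; rewrite ?mulr1 ?mulr0.
case=> f fE [x fx]; exists (\row_i f (enum_val i)); last first.
  by apply/rV0Pn; exists (enum_rank x); rewrite mxE enum_rankK.
apply/rowP=> j; rewrite !mxE -fE [RHS]big_mkcond.
rewrite (reindex (@enum_val _ (mem (vertex G)))) /=; last first.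
  by apply: onW_bij; apply: enum_val_bij.
apply: eq_bigr => i _; rewrite !mxE adj_sym.
by case: adj; rewrite ?mulr1 ?mulr0.
Qed.

End Eigenfunctions.

(** * Incidence of vertices and edges *)

Definition regular (G : sgraph) (r : nat) :=
  forall x : vertex G, #|[pred y | adj x y]| = r.

Section Incidence.

Variable G : sgraph.

Lemma adj_edge (x y : vertex G) : adj x y -> is_edge [set x; y].
Proof. by move=> xy; apply/existsP; exists x; apply/existsP; exists y; rewrite xy eqxx. Qed.

Lemma edgeE (e : edge G) : exists x y, adj x y /\ val e = [set x; y].
Proof.
by case: e => e /= /existsP[x /existsP[y /andP[xy /eqP->]]]; exists x, y.
Qed.

Lemma adj_neq (x y : vertex G) : adj x y -> x != y.
Proof. by apply: contraTneq => ->; rewrite adj_irrefl. Qed.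

Lemma card_edge (e : edge G) : #|val e| = 2%N.
Proof. by have [x [y [xy ->]]] := edgeE e; rewrite cards2 (adj_neq xy). Qed.

(** The edges at [x] correspond to their other endpoints. The weight [h] lives on all vertex sets,
    so that [h [set x; y]] needs no proof that the pair is an edge. *)
Lemma sum_incident (R : nmodType) (h : {set vertex G} -> R) x :
  \sum_(e : edge G | x \in val e) h (val e) = \sum_(y | adj x y) h [set x; y].
Proof.
(* The default [x] is returned only for edges that avoid [x]. *)
pose other (e : edge G) := odflt x [pick y | val e == [set x; y]].
have set2I (y z : vertex G) : [set x; y] = [set x; z] -> adj x y -> y = z.
  move=> /setP/(_ y); rewrite !inE eqxx orbT => /esym/orP[/eqP->|/eqP//].
  by rewrite adj_irrefl.
have otherP (e : edge G) : x \in val e ->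
    adj x (other e) /\ val e = [set x; other e].
  move=> xe; rewrite /other; case: pickP => [y /eqP eE|none] /=.
    split=> //; have [u [v [uv]]] := edgeE e.
    rewrite eE => /esym uvE.
    have ux : u \in [set x; y] by rewrite -uvE set21.
    have vx : v \in [set x; y] by rewrite -uvE set22.
    have := adj_neq uv.
    move: ux vx uv; rewrite !inE => /orP[]/eqP-> /orP[]/eqP->; rewrite ?eqxx //.
    by rewrite adj_sym.
  have [u [v [uv eE]]] := edgeE e; move: xe; rewrite eE !inE => /orP[]/eqP xE.
    by have := none v; rewrite eE xE eqxx.
  by have := none u; rewrite eE xE setUC eqxx.
rewrite [RHS](reindex_omap other (fun y => insub [set x; y])) /=; last first.
  move=> y xy; rewrite (insubT _ (adj_edge xy)) /=; congr Some.
  have [|_ /= /set2I/(_ xy)/esym//] := otherP (Sub [set x; y] (adj_edge xy)).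
  exact: set21.
have condE (e : edge G) : (x \in val e) =
    adj x (other e) && (insub [set x; other e] == Some e).
  apply/idP/andP=> [/otherP[xo eE]|[_]]; first by rewrite -eE valK eqxx.
  by case: insubP => //= e' _ e'E /eqP[<-]; rewrite e'E set21.
by apply: eq_big => [e|e /otherP[_ {1}->]]; first exact: condE.
Qed.

(* An edge meets itself in two vertices and each of its neighbours in one. *)
Lemma sum_line_adj (R : pzRingType) (g : edge G -> R) (e : edge G) :
  \sum_(x in val e) \sum_(d : edge G | x \in val d) g d =
  \sum_(d | line_rel e d) g d + g e *+ 2.
Proof.
rewrite (exchange_big_dep predT) //= (bigD1 e) //= addrC; congr (_ + _); last first.
  rewrite (eq_bigl (mem (val e))) ?sumr_const ?card_edge //.
  by move=> x /=; rewrite andbb.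
rewrite [LHS](bigID (fun d => line_rel e d)) /= [X in _ + X]big1 ?addr0.
  apply: eq_big => [d|d /andP[dne /andP[_ meet]]].
    by rewrite /line_rel eq_sym andbA andbb.
  rewrite (eq_bigl (fun x => x \in val e :&: val d)) => [|x]; last by rewrite inE.
  rewrite sumr_const (_ : #|_| = 1%N) //.
  apply/eqP; rewrite eqn_leq card_gt0 meet andbT -ltnS -(card_edge e).
  rewrite proper_card // properEneq subsetIl andbT.
  apply: contra dne => /eqP/setIidPl ed; apply/eqP/esym/val_inj/eqP.
  by rewrite eqEcard ed !card_edge.
move=> d /andP[dne]; rewrite /line_rel eq_sym dne /= negbK => /eqP ed0.
by apply: big1 => x xed; have := in_set0 x; rewrite -ed0 inE xed.
Qed.

Lemma card_incident (x : vertex G) :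
  #|[pred e : edge G | x \in val e]| = #|[pred y | adj x y]|.
Proof.
rewrite -!sum1_card.
exact: (sum_incident (R := nat) (fun=> 1%N)).
Qed.

Lemma handshake r : regular G r -> (#|vertex G| * r = #|edge G| * 2)%N.
Proof.
move=> regG; rewrite -!sum_nat_const.
rewrite (eq_bigr (fun x => \sum_(e : edge G | x \in val e) 1%N)) => [|x _]; last first.
  by rewrite sum1_card card_incident regG.
rewrite (exchange_big_dep predT) //=; apply: eq_bigr => e _.
by rewrite sum1_card; apply: card_edge.
Qed.

Lemma line_graph_nonempty r : regular G r -> (0 < r)%N ->
  (0 < #|vertex G|)%N -> (0 < #|vertex (line_graph G)|)%N.
Proof.
move=> regG r_gt0 G_gt0; have : (0 < #|vertex G| * r)%N by rewrite muln_gt0 G_gt0.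
by rewrite (handshake regG) muln_gt0 => /andP[].
Qed.

(** Constant weight 1 in [sum_line_adj]. The subtraction never truncates at an actual vertex [e] of
    the line graph, since such an edge forces r > 0. *)
Lemma regular_line_graph r : regular G r -> regular (line_graph G) (2 * r - 2).
Proof.
move=> regG e; have := sum_line_adj (R := int) (fun=> 1) e.
under eq_bigr => x _ do rewrite sumr_const card_incident regG.
rewrite !sumr_const card_edge /= => h.
have {h} : (r * 2 = #|[pred d | line_rel e d]| + 2)%N.
  by apply/eqP; rewrite -(eqr_nat int) natrD !mulrnA; apply/eqP.
by move=> h; rewrite mulnC h addnK.
Qed.

End Incidence.

(** * Spectrum of the line graph of a regular graph *)

Section LineSpectrum.

Variables (C : numFieldType) (G : sgraph) (r : nat).
Hypothesis regG : regular G r.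
Local Notation specG := (eigenvalue (adjacency_mx C G)).
Local Notation specL := (eigenvalue (adjacency_mx C (line_graph G))).

Lemma regular_eigenvalue : (0 < #|vertex G|)%N -> specG r%:R.
Proof.
case/card_gt0P=> x _; apply/eigenvalue_adjacencyP.
exists (fun=> 1); last by exists x; rewrite oner_eq0.
by move=> y; rewrite sumr_const regG mulr1.
Qed.

(** The triangle inequality, summed over all vertices, bounds |a| times the l1 norm of [f] by r
    times that norm, because each |f z| is counted once per neighbour of z. *)
Lemma norm_eigenvalue_le a : specG a -> `|a| <= r%:R.
Proof.
case/eigenvalue_adjacencyP=> f fE [x fx].
have S_gt0 : 0 < \sum_y `|f y|.
  apply: lt_le_trans (_ : `|f x| <= _); first by rewrite normr_gt0.
  by rewrite (bigD1 x) //= lerDl sumr_ge0.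
rewrite -(ler_pM2r S_gt0) !mulr_sumr.
apply: le_trans (_ : \sum_y \sum_(z | adj y z) `|f z| <= _).
  apply: ler_sum => y _; rewrite -normrM -fE; exact: ler_norm_sum.
rewrite (exchange_big_dep predT) //=; apply: ler_sum => z _.
rewrite sumr_const mulr_natl (eq_card (B := [pred y | adj z y])) ?regG //.
by move=> y; rewrite !inE adj_sym.
Qed.

(** An eigenfunction f lifts to B^T f, which gives an edge the sum of f over its ends. Since B B^T f
    = (a + r) f, the lift is nonzero when a + r is. *)
Lemma line_graph_eigenvalue a :
  specG a -> a + r%:R != 0 -> specL (a + r%:R - 2).
Proof.
case/eigenvalue_adjacencyP=> f fE [x fx] ar0; apply/eigenvalue_adjacencyP.
pose h (s : {set vertex G}) := \sum_(y in s) f y.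
have hE y : \sum_(e : edge G | y \in val e) h (val e) = (a + r%:R) * f y.
  rewrite sum_incident; under eq_bigr => z yz.
    rewrite /h big_setU1 ?inE ?(adj_neq yz) //= big_set1; over.
  rewrite big_split /= fE sumr_const (regG y) mulrDl addrC.
  by rewrite mulr_natl.
exists (fun e : edge G => h (val e)).
  move=> e /=; apply: (addIr (h (val e) *+ 2)).
  rewrite -(sum_line_adj (fun d : edge G => h (val d))).
  under eq_bigr => y _ do rewrite hE.
  by rewrite -mulr_sumr -/(h (val e)) mulrBl mulr_natl subrK.
have [e xe he] : exists2 e : edge G, x \in val e & h (val e) != 0.
  apply/exists_inP; apply: contraR ar0; rewrite negb_exists_in => /forall_inP h0.
  have /eqP := hE x; rewrite big1 => [|e xe].
    by rewrite eq_sym mulf_eq0 (negPf fx) orbF.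
  by apply/eqP; have := h0 e xe; rewrite negbK.
by exists e.
Qed.

(* There are more edges than vertices, so some nonzero weighting of the edges
   sums to zero around every vertex. *)
Lemma line_graph_eigenvalueN2 :
  (2 < r)%N -> (0 < #|vertex G|)%N -> specL (- 2).
Proof.
move=> r_gt2 G_gt0; have n_lt_m : (#|vertex G| < #|edge G|)%N by have := handshake regG; nia.
pose B : 'M[C]_(#|edge G|, #|vertex G|) :=
  \matrix_(i, j) ((enum_val j : vertex G) \in val (enum_val i : edge G))%:R.
(* [kermx] is the left kernel, hence consists of edge weightings; the rank of [B] is at most the
   number of vertices. *)
have : kermx B != 0.
  by rewrite -mxrank_eq0 mxrank_ker subn_eq0 -ltnNge (leq_ltn_trans (rank_leq_col B)).
rewrite -nz_row_eq0; set v := nz_row _ => v0.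
have vB : v *m B = 0 by apply/sub_kermxP; apply: nz_row_sub.
apply/eigenvalue_adjacencyP; exists (fun e : edge G => v ord0 (enum_rank e)).
  move=> e /=; apply: (addIr (v ord0 (enum_rank e) *+ 2)).
  rewrite -(sum_line_adj (fun d : edge G => v ord0 (enum_rank d))).
  rewrite mulNr mulr_natl addNr; apply: big1 => x _.
  move/rowP/(_ (enum_rank x)): vB; rewrite !mxE => vB; rewrite -[RHS]vB.
  rewrite big_mkcond (reindex (@enum_val _ (mem (edge G)))) /=; last first.
    by apply: onW_bij; apply: enum_val_bij.
  apply: eq_bigr => i _; rewrite mxE enum_rankK enum_valK.
  by case: ifP; rewrite ?mulr1 ?mulr0.
by case/rV0Pn: v0 => i vi; exists (enum_val i); rewrite enum_valK.
Qed.

End LineSpectrum.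

(* By the spectral theorem A^2 = r^2 would hold if all eigenvalues were r or -r,
   whereas the diagonal entries of A^2 are the degrees. *)
Lemma exists_other_eigenvalue (C : numClosedFieldType) (G : sgraph) (r : nat) :
  regular G r -> (1 < r)%N -> (0 < #|vertex G|)%N ->
  exists a : C,
    [/\ eigenvalue (adjacency_mx C G) a, a != r%:R & a != - r%:R].
Proof.
move=> regG r_gt1 /card_gt0P[x _]; set A := adjacency_mx C G.
have A_normal : A \is normalmx.
  apply: hermitian_normalmx; apply: realsym_hermsym.
    by apply/is_hermitianmxP; apply/matrixP=> i j; rewrite !mxE expr0 mul1r adj_sym.
  by apply/mxOverP=> i j; rewrite mxE realn.
have /orthomx_spectralP := A_normal.
set P := spectralmx A; set d := spectral_diag A => A_E.
have Pu : P \in unitmx := spectral_unit A.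
case: (pickP (fun i => d 0 i ^+ 2 != r%:R ^+ 2)) => [i di|d2].
  move: di; rewrite eqf_sqr negb_or => /andP[dr dNr].
  (* From A = P^-1 D P follows P A = D P, so the rows of [P] are eigenvectors; they are nonzero
     because [P] is invertible. *)
  exists (d 0 i); split=> //; apply/eigenvalueP; exists (row i P).
    rewrite {1}A_E -row_mul mulmxA mulmxA mulmxV // mul1mx.
    by rewrite row_mul row_diag_mx -scalemxAl -rowE.
  rewrite -unitmx_tr in Pu.
  apply: contraTneq Pu => Pi0; rewrite unitmxE.
  rewrite -det_tr trmxK (expand_det_row _ i) big1 ?unitr0 // => j _.
  by move/rowP/(_ j): Pi0; rewrite !mxE => ->; rewrite mul0r.
have D2 : diag_mx d *m diag_mx d = (r%:R ^+ 2)%:M.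
  rewrite -diag_const_mx mulmx_diag; congr diag_mx.
  by apply/rowP=> i; rewrite !mxE -expr2; apply/eqP/negbFE/d2.
have A2 : A *m A = (r%:R ^+ 2)%:M.
  rewrite A_E !mulmxA mulmxK // -(mulmxA (invmx P)) D2.
  by rewrite mul_mx_scalar -scalemxAl mulVmx // scalemx1.
have : (A *m A) (enum_rank x) (enum_rank x) = r%:R.
  rewrite mxE (reindex (@enum_rank _)) /=; last first.
    by apply: onW_bij; apply: enum_rank_bij.
  rewrite -(regG x) -sumr_const [RHS]big_mkcond; apply: eq_bigr => y _.
  by rewrite !mxE !enum_rankK inE (adj_sym y x); case: adj; rewrite ?mulr1 ?mulr0.
rewrite A2 mxE eqxx mulr1n -natrX => /eqP; rewrite eqr_nat => /eqP.
by nia.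
Qed.

(** * Five eigenvalues when the degree is at least 3 *)

Lemma line3_eigenvalues (C : numClosedFieldType) (G : sgraph) (r : nat) :
  regular G r -> (2 < r)%N -> (0 < #|vertex G|)%N ->
  exists2 s : seq C, uniq s & size s = 5%N /\
    {subset s <= eigenvalue (adjacency_mx C (iter_line_graph 3 G))}.
Proof.
move=> regG r_gt2 G_gt0.
have G1_gt0 : (0 < #|vertex (line_graph G)|)%N.
  by apply: (line_graph_nonempty regG); lia.
have reg1 := regular_line_graph regG.
have G2_gt0 : (0 < #|vertex (line_graph (line_graph G))|)%N.
  by apply: (line_graph_nonempty reg1); lia.
have reg2 := regular_line_graph reg1.
(* With r = t + 3 all degrees become polynomials in t with natural coefficients, free of truncated
   subtraction. *)
have [t tE] : exists t, r = t.+3 by exists (r - 3)%N; lia.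
have rE : r%:R = t%:R + 3 :> C by rewrite tE -addn3 natrD.
have r1E : (2 * r - 2)%:R = 2 * t%:R + 4 :> C.
  have -> : (2 * r - 2 = 2 * t + 4)%N by lia.
  by rewrite natrD natrM.
have r2E : (2 * (2 * r - 2) - 2)%:R = 4 * t%:R + 6 :> C.
  have -> : (2 * (2 * r - 2) - 2 = 4 * t + 6)%N by lia.
  by rewrite natrD natrM.
have nat_neq0 p q : 2 * p%:R * t%:R + q.+1%:R != 0 :> C.
  by rewrite -!natrM -natrD pnatr_eq0; lia.
have [a [eig_a a_r a_Nr]] := exists_other_eigenvalue C regG (ltnW r_gt2) G_gt0.
(* Here |b| <= r < k rules out b = -k. *)
have a_neq0 b k : eigenvalue (adjacency_mx C G) b -> (r < k)%N -> b + k%:R != 0.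
  move=> /(norm_eigenvalue_le regG) b_le rk; rewrite addr_eq0.
  apply: contraTneq b_le => ->; rewrite normrN normr_nat ler_nat; lia.
have line3 b c : eigenvalue (adjacency_mx C G) b -> b + r%:R != 0 ->
    c = b + 7 * t%:R + 7 ->
    eigenvalue (adjacency_mx C (iter_line_graph 3 G)) c.
  move=> eig_b br0 ->; have e1 := line_graph_eigenvalue regG eig_b br0.
  have nz1 : b + r%:R - 2 + (2 * r - 2)%:R != 0.
    have := @a_neq0 _ (3 * t + 5)%N eig_b; rewrite natrD natrM => h.
    rewrite rE r1E (_ : _ + _ + _ = b + (3 * t%:R + 5)); first by apply: h; lia.
    by ring.
  have e2 := line_graph_eigenvalue reg1 e1 nz1.
  have nz2 : b + r%:R - 2 + (2 * r - 2)%:R - 2 + (2 * (2 * r - 2) - 2)%:R != 0.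
    have := @a_neq0 _ (7 * t + 9)%N eig_b; rewrite natrD natrM => h.
    rewrite rE r1E r2E (_ : _ + _ + _ = b + (7 * t%:R + 9)); first by apply: h; lia.
    by ring.
  have := line_graph_eigenvalue reg2 e2 nz2.
  by rewrite rE r1E r2E (_ : _ + _ - 2 = b + 7 * t%:R + 7) //; ring.
(* The first three come from the eigenvalue -2 of the third, second and first line graph, the last
   two from r and a. Each pairwise difference is a positive integer, a + k with k > r, a + r or a -
   r. *)
exists [:: -2; 4 * t%:R + 2; 6 * t%:R + 4; 8 * t%:R + 10; a + 7 * t%:R + 7].
  have neqP (x y z : C) : z != 0 -> y - x = z -> x != y.
    by move=> z0 yx; rewrite eq_sym -subr_eq0 yx.
  have a_nz k := @a_neq0 a k eig_a.
  rewrite /= !inE !negb_or -!andbA; do !(apply/andP; split=> //).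
  - by apply: (neqP _ _ _ (nat_neq0 2 3)); ring.
  - by apply: (neqP _ _ _ (nat_neq0 3 5)); ring.
  - by apply: (neqP _ _ _ (nat_neq0 4 11)); ring.
  - apply: (neqP _ _ _ (a_nz (7 * t + 9)%N _)); first by lia.
    by rewrite natrD natrM; ring.
  - by apply: (neqP _ _ _ (nat_neq0 1 1)); ring.
  - by apply: (neqP _ _ _ (nat_neq0 2 7)); ring.
  - apply: (neqP _ _ _ (a_nz (3 * t + 5)%N _)); first by lia.
    by rewrite natrD natrM; ring.
  - by apply: (neqP _ _ _ (nat_neq0 1 5)); ring.
  - apply: (neqP _ _ (a + r%:R)); first by rewrite addr_eq0.
    by rewrite rE; ring.
  - apply: (neqP _ _ (a - r%:R)); first by rewrite subr_eq0.
    by rewrite rE; ring.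
split=> // c; rewrite !inE => /or4P[/eqP->|/eqP->|/eqP->|].
- by apply: (line_graph_eigenvalueN2 C reg2); rewrite //; lia.
- have e2 : eigenvalue (adjacency_mx C (line_graph (line_graph G))) (- 2).
    by apply: (line_graph_eigenvalueN2 C reg1); rewrite //; lia.
  have := line_graph_eigenvalue reg2 e2; rewrite r2E.
  rewrite (_ : - 2 + _ = 2 * 2 * t%:R + 4) => [/(_ (nat_neq0 2 3))|]; last by ring.
  by rewrite (_ : _ - 2 = 4 * t%:R + 2) //; ring.
- have e1 : eigenvalue (adjacency_mx C (line_graph G)) (- 2).
    exact: (line_graph_eigenvalueN2 C regG).
  have := line_graph_eigenvalue reg1 e1; rewrite r1E.
  rewrite (_ : - 2 + _ = 2 * 1 * t%:R + 2) => [/(_ (nat_neq0 1 1)) e2|]; last by ring.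
  have := line_graph_eigenvalue reg2 e2; rewrite r2E.
  rewrite (_ : _ + (_ + 6) = 2 * 3 * t%:R + 6) => [/(_ (nat_neq0 3 5))|]; last by ring.
  by rewrite (_ : _ - 2 = 6 * t%:R + 4) //; ring.
case/orP=> /eqP->.
  apply: (line3 r%:R); first exact: regular_eigenvalue.
    by rewrite -natrD pnatr_eq0; lia.
  by rewrite rE; ring.
by apply: (line3 a) => //; rewrite addr_eq0.
Qed.

(** Truncated subtraction gives the second line graph degree 0, so it has no edges. *)
Lemma regular_le1_line3 (G : sgraph) (r : nat) :
  regular G r -> (r <= 1)%N -> #|vertex (iter_line_graph 3 G)| = 0%N.
Proof.
move=> regG r1; have reg2 := regular_line_graph (regular_line_graph regG).
have := handshake reg2; rewrite (_ : 2 * _ - 2 = 0)%N; last by lia.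
by rewrite muln0 => /esym/eqP; rewrite muln_eq0 orbF => /eqP.
Qed.

(** * Cycles and their line graphs *)

(** The labels form the ring Z/(n+3), where [+ 1] wraps around; the offset 3 makes 2 nonzero, so i +
    1 and i - 1 differ. *)
Definition is_cycle (n : nat) (G : sgraph) :=
  exists2 e : 'I_n.+3 -> vertex G, bijective e &
    forall i j, adj (e i) (e j) = (j == i + 1) || (i == j + 1).

Section Cycle.

Variables (n : nat) (G : sgraph).
Hypothesis cycG : is_cycle n G.

Lemma ord_two_neq0 : (1 + 1 : 'I_n.+3) != 0.
Proof. by rewrite -val_eqE. Qed.

(** The edge from i to i + 1 receives the label i; consecutive edges share the vertex between
    them. *)
Lemma is_cycle_line_graph : is_cycle n (line_graph G).
Proof.
have [e [e' eK e'K] eE] := cycG.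
have e_inj := can_inj eK.
have edgeP i : is_edge [set e i; e (i + 1)] by apply: adj_edge; rewrite eE eqxx.
pose d i : vertex (line_graph G) := Sub [set e i; e (i + 1)] (edgeP i).
have d_inj : injective d.
  (* Equal edges with i != j would give j = i + 1 and i = j + 1, hence 2 = 0. *)
  move=> i j /(congr1 val) /= /setP dij; apply/eqP; apply: contraNT ord_two_neq0 => ij.
  have := dij (e i); have := dij (e j); rewrite !inE !(inj_eq e_inj) !eqxx /=.
  rewrite (negPf ij) eq_sym (negPf ij) /= => /eqP jE /esym /eqP iE.
  by rewrite -(inj_eq (addrI j)) addr0 addrA -iE -jE.
have d_surj x : exists i, x == d i.
  have [u [v [uv xE]]] := edgeE x; move: uv xE.
  rewrite -(e'K u) -(e'K v) eE => /orP[]/eqP-> xE.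
    by exists (e' u); rewrite -val_eqE /= xE.
  by exists (e' v); rewrite -val_eqE /= xE setUC.
exists d.
  exists (fun x => xchoose (d_surj x)) => [i|x].
    by apply: d_inj; apply/esym/eqP; apply: (xchooseP (d_surj (d i))).
  by apply/esym/eqP; apply: (xchooseP (d_surj x)).
move=> i j; rewrite /= /line_rel (inj_eq d_inj) /=.
have -> : ([set e i; e (i + 1)] :&: [set e j; e (j + 1)] != set0) =
    [|| i == j, j == i + 1 | i == j + 1].
  apply/set0Pn/idP=> [[x]|].
    rewrite !inE => /andP[/orP[]/eqP-> ]; rewrite !(inj_eq e_inj) ?(inj_eq (addIr 1)).
      by case/orP=> ->; rewrite ?orbT.
    by case/orP; rewrite eq_sym => ->; rewrite ?orbT.
  case/or3P=> /eqP->; first by exists (e j); rewrite !inE eqxx.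
    by exists (e (i + 1)); rewrite !inE !eqxx orbT.
  by exists (e (j + 1)); rewrite !inE !eqxx orbT.
have [->|] := eqVneq i j => //=.
by rewrite orbb eq_sym -subr_eq0 addrC addKr oner_eq0.
Qed.

Lemma cycle_eigenvalueP (F : fieldType) (a : F) :
  eigenvalue (adjacency_mx F G) a <->
  exists2 f : 'I_n.+3 -> F, forall i, f (i + 1) + f (i - 1) = a * f i
    & exists i, f i != 0.
Proof.
have [e e_bij eE] := cycG; have [e' eK e'K] := e_bij.
have sumE (f : vertex G -> F) i : \sum_(y | adj (e i) y) f y = f (e (i + 1)) + f (e (i - 1)).
  rewrite (reindex e) /=; last exact: onW_bij.
  rewrite (eq_bigl (fun j => j \in [set i + 1; i - 1])); last first.
    by move=> j; rewrite !inE eE (eq_sym i) (can2_eq (addrK 1) (subrK 1)).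
  rewrite big_setU1 /= ?big_set1 // inE -(inj_eq (addIr 1)) subrK.
  by rewrite -[X in _ == X]addr0 -addrA (inj_eq (addrI i)) ord_two_neq0.
split=> [/eigenvalue_adjacencyP[f fE [x fx]]|[f fE [i fi]]].
  exists (f \o e) => [i|]; first by rewrite /= -sumE fE.
  by exists (e' x); rewrite /= e'K.
apply/eigenvalue_adjacencyP; exists (f \o e'); last by exists (e i); rewrite /= eK.
by move=> x; rewrite -(e'K x) sumE /= !eK.
Qed.

(** The eigenfunction is unrolled to a periodic sequence on [nat], which turns the eigenvalue
    equation into a linear recurrence. *)
Lemma cycle_recurrence (F : fieldType) (a : F) :
  eigenvalue (adjacency_mx F G) a ->
  exists g : nat -> F,
    [/\ forall k, g k.+2 + g k = a * g k.+1, forall k, g (k + n.+3)%N = g k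
      & exists k, g k != 0].
Proof.
case/cycle_eigenvalueP=> f fE [i fi]; exists (fun k => f k%:R); split.
- move=> k; have := fE k.+1%:R; rewrite natr1 (_ : k.+1%:R - 1 = k%:R) //.
  by rewrite -natr1 addrK.
- by move=> k; rewrite natrD (@pchar_Zp n.+3) ?addr0.
- by exists i; rewrite natr_Zp.
Qed.

End Cycle.

(** * Spectra of the cycles of length 3, 4 and 6 *)

Lemma eigenvalue_C3 (F : fieldType) (G : sgraph) (a : F) : is_cycle 0 G ->
  eigenvalue (adjacency_mx F G) a -> a \in [:: 2; -1].
Proof.
move=> cycG /(cycle_recurrence cycG)[g [gE gP [k gk]]].
have e0 := gE k; have e1 := gE k.+1; have e2 := gE k.+2.
have p0 : g k.+3 = g k by rewrite -(gP k) addn3.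
have p1 : g k.+4 = g k.+1 by rewrite -(gP k.+1) addn3.
rewrite p0 p1 in e1 e2.
have : (a - 2) * (a + 1) * g k = 0.
  (* Each bracket vanishes by the recurrence. With p(x) = (x - 2)(x + 1) and p(A) = 0, the cofactors
     are the entries of a row of (p(a) - p(A)) / (a - A) = a + A - 1. *)
  transitivity ((a * g k - (g k.+1 + g k.+2)) * (a - 1)
    + (a * g k.+1 - (g k.+2 + g k)) + (a * g k.+2 - (g k + g k.+1))); first by ring.
  by rewrite -e0 -e1 -e2; ring.
move/eqP; rewrite !mulf_eq0 (negPf gk) orbF subr_eq0 addr_eq0.
by rewrite !inE.
Qed.

Lemma eigenvalue_C4 (F : fieldType) (G : sgraph) (a : F) : is_cycle 1 G ->
  eigenvalue (adjacency_mx F G) a -> a \in [:: 2; 0; -2].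
Proof.
move=> cycG /(cycle_recurrence cycG)[g [gE gP [k gk]]].
have e0 := gE k; have e1 := gE k.+1; have e2 := gE k.+2; have e3 := gE k.+3.
have p0 : g k.+4 = g k by rewrite -(gP k) addn4.
have p1 : g k.+1.+4 = g k.+1 by rewrite -(gP k.+1) addn4.
rewrite p0 p1 in e2 e3.
have : (a - 2) * (a * (a + 2)) * g k = 0.
  (* The same with p(x) = x^3 - 4x: the cofactors are read off from a^2 + aA + A^2 - 4. *)
  transitivity ((a * g k - (g k.+1 + g k.+3)) * (a * a - 2)
    + (a * g k.+1 - (g k.+2 + g k)) * a
    + (a * g k.+2 - (g k.+3 + g k.+1)) * 2
    + (a * g k.+3 - (g k + g k.+2)) * a); first by ring.
  by rewrite -e0 -e1 -e2 -e3; ring.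
move/eqP; rewrite !mulf_eq0 (negPf gk) orbF subr_eq0 addr_eq0.
by rewrite !inE.
Qed.

Lemma eigenvalue_C6 (F : numFieldType) (G : sgraph) (a : F) : is_cycle 3 G ->
  (a \in [:: 2; 1; -1; -2]) = eigenvalue (adjacency_mx F G) a.
Proof.
move=> cycG; apply/idP/idP.
  have eig (z : int) (s : seq int) : s`_0 != 0 ->
      [forall i : 'I_6, s`_(i + 1 : 'I_6)%R + s`_(i - 1 : 'I_6)%R == z * s`_i] ->
      eigenvalue (adjacency_mx F G) z%:~R.
    move=> s0 /forallP sE; apply/(cycle_eigenvalueP cycG).
    exists (fun i => (s`_i)%:~R); last by exists 0; rewrite intr_eq0.
    by move=> i; rewrite -intrD -intrM (eqP (sE i)).
  have dec (P : pred 'I_6) : all P [:: 0; 1; 2; 3; 4; 5] -> [forall i, P i].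
    move=> /allP aP; apply/forallP=> i; apply: aP.
    by case: i => [[|[|[|[|[|[|]]]]]]].
  (* The lists are multiples of i -> cos(2 pi j i / 6) for j = 0, 1, 2, 3, with eigenvalue 2 cos(2
     pi j / 6). Being integral, they are checked by computation. *)
  rewrite !inE => /or4P[]/eqP->.
  - by apply: (eig 2 [:: 1; 1; 1; 1; 1; 1]) => //; apply: dec.
  - by apply: (eig 1 [:: 2; 1; -1; -2; -1; 1]) => //; apply: dec.
  - by apply: (eig (-1) [:: 2; -1; -1; 2; -1; -1]) => //; apply: dec.
  - by apply: (eig (-2) [:: 1; -1; 1; -1; 1; -1]) => //; apply: dec.
move=> /(cycle_recurrence cycG)[g [gE gP [k gk]]].
have e0 := gE k; have e1 := gE k.+1; have e2 := gE k.+2; have e3 := gE k.+3.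
have e4 := gE k.+4; have e5 := gE k.+1.+4.
have p0 : g k.+2.+4 = g k by rewrite -(gP k) addnC.
have p1 : g k.+3.+4 = g k.+1 by rewrite -(gP k.+1) addnC.
rewrite p0 p1 in e4 e5.
(* On C_6, A^2 - 1 sends each basis vector to the sum of its parity class. *)
have : (a - 2) * ((a - 1) * ((a + 1) * (a + 2))) * g k = 0.
  have E0 : (a * a - 1) * g k = g k + g k.+2 + g k.+4.
    have -> : (a * a - 1) * g k = a * (a * g k) - g k by ring.
    by rewrite -e5 mulrDr -e0 -e4; ring.
  have E2 : (a * a - 1) * g k.+2 = g k + g k.+2 + g k.+4.
    have -> : (a * a - 1) * g k.+2 = a * (a * g k.+2) - g k.+2 by ring.
    by rewrite -e1 mulrDr -e0 -e2; ring.
  have E4 : (a * a - 1) * g k.+4 = g k + g k.+2 + g k.+4.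
    have -> : (a * a - 1) * g k.+4 = a * (a * g k.+4) - g k.+4 by ring.
    by rewrite -e3 mulrDr -e2 -e4; ring.
  (* Multiplying the class sum by a^2 - 1 triples it, which yields the factor a^2 - 4. *)
  transitivity ((a * a - 1) * ((a * a - 1) * g k - 3 * g k)); first by ring.
  by rewrite E0 mulrBr !mulrDr mulrCA E0 E2 E4; ring.
move/eqP; rewrite !mulf_eq0 (negPf gk) orbF !subr_eq0 !addr_eq0.
by rewrite !inE.
Qed.

(** * Degrees of the unitary Cayley graphs *)

(** The gcd with n + 1 ignores signs and multiples of n + 1, so the integer difference may be
    replaced by a residue. *)
Lemma unitary_relE n (i j : 'I_n.+1) :
  unitary_rel i j = (j - i != 0) && coprime (j - i)%R n.+1.
Proof.
rewrite /unitary_rel subr_eq0 eq_sym; congr (_ && _).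
rewrite -opprB gcdNz /coprime /= modnDmr gcdn_modl -eqz_nat; congr (_ == _).
rewrite gcdzC -gcdzDr gcdnC (_ : _ + _ = (j + (n.+1 - i))%N%:Z) //.
by have := ltn_ord i; lia.
Qed.

Lemma regular_unitary_cayley n : regular (unitary_cayley n.+1)
  #|[pred k : 'I_n.+1 | (k != 0) && coprime k n.+1]|.
Proof.
move=> i; rewrite -!sum1_card (reindex (fun k => i + k)) /=; last first.
  by apply: onW_bij; exists (fun k => k - i) => k; rewrite addrC ?addKr ?addrNK.
by apply: eq_bigl => k; rewrite !inE unitary_relE addrC addKr.
Qed.

(** This supplies a unit besides 1 and n - 1, hence degree at least 3. For odd n it is 2; for n = 2m
    it is whichever of m + 1 and m + 2 is odd, its gcd with m being 1. *)
Lemma exists_coprime_between n : (n == 5) || (6 < n)%N ->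
  exists u, [/\ (1 < u)%N, (u < n.-1)%N & coprime u n].
Proof.
move=> n_large; have [n_odd|n_even] := boolP (odd n).
  by exists 2%N; rewrite coprime2n; split=> //; lia.
have nE : n = (n./2 * 2)%N by have := odd_double_half n; lia.
set m := n./2 in nE.
have m_ge4 : (3 < m)%N by lia.
have [m_odd|m_even] := boolP (odd m).
  exists (m + 2)%N; split; try lia.
  rewrite nE coprimeMr coprimen2 oddD m_odd andbT.
  by rewrite coprime_sym /coprime gcdnDl -/(coprime m 2) coprimen2.
exists (m + 1)%N; split; try lia.
rewrite nE coprimeMr coprimen2 oddD (negPf m_even) andbT.
by rewrite coprime_sym /coprime gcdnDl gcdn1.
Qed.

Lemma unitary_cayley_degree_gt2 n : (n.+1 == 5) || (6 < n.+1)%N ->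
  (2 < #|[pred k : 'I_n.+1 | (k != 0)%R && coprime k n.+1]|)%N.
Proof.
move=> n_large; have [u [u_gt1 u_lt u_cop]] := exists_coprime_between n_large.
have in_deg k : (0 < k)%N -> (k < n.+1)%N -> coprime k n.+1 ->
    inord k \in [pred k : 'I_n.+1 | (k != 0) && coprime k n.+1].
  by move=> k_gt0 k_lt k_cop; rewrite inE -val_eqE /= inordK // k_cop -lt0n k_gt0.
have inord_neq (k l : nat) : (k < n.+1)%N -> (l < n.+1)%N -> k != l ->
    inord k != inord l :> 'I_n.+1.
  by move=> k_lt l_lt; rewrite -val_eqE /= !inordK.
apply/card_gt2P; exists (inord 1), (inord u), (inord n).
split; split; (apply: in_deg || apply: inord_neq) => //; try lia.
- exact: coprime1n.
- exact: coprimenS.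
Qed.

(** When 1 and -1 are the only units, the residues themselves label the cycle. This serves n = 3, 4
    and 6. *)
Lemma is_cycle_unitary_cayley n :
  (forall k : 'I_n.+3, (k != 0) && coprime k n.+3 = (k == 1) || (k == -1)) ->
  is_cycle n (unitary_cayley n.+3).
Proof.
move=> units; exists id => [|i j]; first by exists id.
rewrite /= unitary_relE units subr_eq addrC; congr (_ || _).
by rewrite subr_eq addrC -subr_eq opprK eq_sym.
Qed.

(** * Counting eigenvalues and the case distinction on n *)

Lemma has_exactly_distinct_eigenvalues_ge (F : fieldType) m (A : 'M[F]_m) k s :
  has_exactly_distinct_eigenvalues A k -> uniq s ->
  {subset s <= eigenvalue A} -> (size s <= k)%N.
Proof.
case=> t [_ <- tE] s_uniq sA; apply: uniq_leq_size => // a /sA.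
by rewrite tE.
Qed.

Lemma has_exactly_distinct_eigenvalues_le (F : fieldType) m (A : 'M[F]_m) k s :
  has_exactly_distinct_eigenvalues A k ->
  (forall a, eigenvalue A a -> a \in s) -> (k <= size s)%N.
Proof.
case=> t [t_uniq <- tE] sA; apply: uniq_leq_size => // a.
by rewrite tE; apply: sA.
Qed.

Theorem theorem4p11 (C : numClosedFieldType) (n : nat) (n_gt0 : (0 < n)%N) :
  has_exactly_distinct_eigenvalues
    (adjacency_mx C (iter_line_graph 3 (unitary_cayley n))) 4
  <-> n = 6%N.
Proof.
have line3 k G : is_cycle k G -> is_cycle k (iter_line_graph 3 G).
  by move=> cycG; do 3!apply: is_cycle_line_graph.
split=> [eig4|->]; last first.
  exists [:: 2; 1; -1; -2]; split=> //.
    (* Distinctness is decided in [int] and carried over by injectivity of the cast in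
       characteristic 0. *)
    suff : uniq [seq z%:~R : C | z <- [:: 2; 1; -1; -2] : seq int] by [].
    by rewrite map_inj_uniq //; apply: intr_inj.
  move=> a; apply: eigenvalue_C6; apply/line3/is_cycle_unitary_cayley.
  by case=> [[|[|[|[|[|[|]]]]]]].
have [|n_small] := boolP ((n == 5) || (6 < n))%N.
  case: n n_gt0 eig4 => // n _ eig4 n_large.
  have [//||s s_uniq [sz sE]] := @line3_eigenvalues C _ _ (@regular_unitary_cayley n).
  - exact: unitary_cayley_degree_gt2.
  - by rewrite card_ord.
  by have := has_exactly_distinct_eigenvalues_ge eig4 s_uniq sE; rewrite sz.
have [n_le2|n_gt2] := leqP n 2.
  case: n n_gt0 eig4 n_le2 {n_small} => // n _ eig4 n_le2.
  (* For order at most 2 there is at most one nonzero residue. *)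
  have degree_le1 : (#|[pred k : 'I_n.+1 | (k != 0)%R && coprime k n.+1]| <= 1)%N.
    apply: leq_trans (_ : #|predC1 (0%R : 'I_n.+1)| <= _)%N.
      by apply: subset_leq_card; apply/subsetP=> k /andP[].
    by rewrite cardC1 card_ord.
  have empty := regular_le1_line3 (@regular_unitary_cayley n) degree_le1.
  (* A graph without vertices has no eigenvalue, so the empty list covers the spectrum. *)
  suff : (4 <= size ([::] : seq C))%N by [].
  apply: (has_exactly_distinct_eigenvalues_le eig4) => a.
  case/eigenvalue_adjacencyP=> f _ [x _].
  by have := fintype0 x empty.
have : n \in [:: 3; 4; 6] by rewrite !inE; lia.
rewrite !inE => /or3P[]/eqP nE; last by [].
  have cyc3 : is_cycle 0 (unitary_cayley 3).
    by apply: is_cycle_unitary_cayley; case=> [[|[|[|]]]].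
  move: eig4; rewrite nE => /has_exactly_distinct_eigenvalues_le.
  by move=> /(_ [:: 2; -1])/(_ (fun a => @eigenvalue_C3 C _ a (line3 _ _ cyc3))).
have cyc4 : is_cycle 1 (unitary_cayley 4).
  by apply: is_cycle_unitary_cayley; case=> [[|[|[|[|]]]]].
move: eig4; rewrite nE => /has_exactly_distinct_eigenvalues_le.
by move=> /(_ [:: 2; 0; -2])/(_ (fun a => @eigenvalue_C4 C _ a (line3 _ _ cyc4))).
Qed.
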